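(* Let $M^2$ be a helicoidal surface (of first type) in the isotropic 3-space $\mathbb{I}^3$ with pitch $h\in\mathbb{R}$, parametrized by $\mathbf{r}(u,v)=(u\cos v,\,u\sin v,\,g(u)+hv)$, and suppose $M^2$ has constant relative curvature $K_0$. Then: (i) when $K_0=0$, $M^2$ has the form $$\mathbf{r}(u,v)=(u\cos v,\,u\sin v,\,g(u)+hv),\qquad g(u)=\sqrt{\alpha u^2-h^2}+h\arctan\left(\frac{h}{\sqrt{\alpha u^2-h^2}}\right),$$ for some $\alpha\in\mathbb{R}^+$; (ii) otherwise, i.e. when $K_0\neq 0$, $M^2$ is of the form $$\mathbf{r}(u,v)=(u\cos v,\,u\sin v,\,g(u)+hv),$$ $$g(u)=\frac14\left(2a(u)-2h\arctan\left(\frac{-2h^2+\gamma u^2}{2h\,a(u)}\right)+\frac{\gamma}{\sqrt{K_0}}\ln\left|\gamma+2\left(K_0u^2+\sqrt{K_0}\,a(u)\right)\right|\right),$$ where $a(u)=\sqrt{K_0u^4-h^2+\gamma u^2}$ and $\gamma\in\mathbb{R}$.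
   Context: The isotropic 3-space $\mathbb{I}^3$ is $\mathbb{R}^3$ with affine coordinates $(x_1,x_2,x_3)$ and the degenerate isotropic metric $dx_1^2+dx_2^2$ (the Euclidean metric of the top view $(x_1,x_2,x_3)\mapsto(x_1,x_2,0)$). A helicoidal surface of first type with pitch $h\in\mathbb{R}$ is obtained by rotating a curve $(f(u),0,g(u))$ about the $x_3$-axis with a simultaneous translation along the axis; taking $f(u)=u$, it is parametrized by $\mathbf{r}(u,v)=(u\cos v,u\sin v,g(u)+hv)$, where $u$ ranges over an interval not containing $0$ and $g$ is of class $C^2$. First fundamental form (of the induced metric): $\mathfrak{g}_{11}=1$, $\mathfrak{g}_{12}=0$, $\mathfrak{g}_{22}=u^2$. Second fundamental form, with respect to the normal field $(0,0,1)$, i.e. $\mathfrak{h}_{ij}=\det(\mathbf{r}_u,\mathbf{r}_v,\mathbf{r}_{ij})/\sqrt{\det(\mathfrak{g}_{ij})}$: $\mathfrak{h}_{11}=g''$, $\mathfrak{h}_{12}=-h/u$, $\mathfrak{h}_{22}=ug'$. The relative curvature is $K=\det(\mathfrak{h}_{ij})/\det(\mathfrak{g}_{ij})$, which here equals $K=\dfrac{u^3g'g''-h^2}{u^4}$.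
   Formalization: g is given by the formulas only up to a global sign and an additive constant; in (i) α=0 is also allowed when h=0 (constant g); in (ii) for K_0<0 the log term is read as the real part, using the principal complex root and logarithm instead of ln of a modulus. *)

(* Defs.v *)
From Stdlib Require Import Reals.
From Coquelicot Require Import Coquelicot.

Open Scope R_scope.

Definition vec3 : Type := (R * R * R)%type.
Definition px1 (p : vec3) : R := fst (fst p).
Definition px2 (p : vec3) : R := snd (fst p).
Definition px3 (p : vec3) : R := snd p.

Definition det3 (a b c : vec3) : R :=
    px1 a * (px2 b * px3 c - px3 b * px2 c)
  - px2 a * (px1 b * px3 c - px3 b * px1 c)
  + px3 a * (px1 b * px2 c - px2 b * px1 c).

(* The degenerate metric dx1^2 + dx2^2 of isotropic 3-space. *)
Definition iso_inner (a b : vec3) : R := px1 a * px1 b + px2 a * px2 b.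

Definition patch : Type := R -> R -> vec3.

Definition du (r : patch) : patch := fun u v =>
  (Derive (fun t => px1 (r t v)) u,
   Derive (fun t => px2 (r t v)) u,
   Derive (fun t => px3 (r t v)) u).

Definition dv (r : patch) : patch := fun u v =>
  (Derive (fun t => px1 (r u t)) v,
   Derive (fun t => px2 (r u t)) v,
   Derive (fun t => px3 (r u t)) v).

Definition g11 (r : patch) (u v : R) : R := iso_inner (du r u v) (du r u v).
Definition g12 (r : patch) (u v : R) : R := iso_inner (du r u v) (dv r u v).
Definition g22 (r : patch) (u v : R) : R := iso_inner (dv r u v) (dv r u v).
Definition det_g (r : patch) (u v : R) : R :=
  g11 r u v * g22 r u v - g12 r u v ^ 2.

Definition second_coeff (r rij : patch) (u v : R) : R :=
  det3 (du r u v) (dv r u v) (rij u v) / sqrt (det_g r u v).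
Definition h11 (r : patch) : R -> R -> R := second_coeff r (du (du r)).
Definition h12 (r : patch) : R -> R -> R := second_coeff r (dv (du r)).
Definition h22 (r : patch) : R -> R -> R := second_coeff r (dv (dv r)).
Definition det_h (r : patch) (u v : R) : R :=
  h11 r u v * h22 r u v - h12 r u v ^ 2.

Definition relative_curvature (r : patch) (u v : R) : R :=
  det_h r u v / det_g r u v.

Definition helicoidal (h : R) (g : R -> R) : patch := fun u v =>
  (u * cos v, u * sin v, g u + h * v).

Definition is_interval (I : R -> Prop) : Prop :=
  forall x y z, I x -> I z -> x <= y <= z -> I y.

(* At an endpoint belonging to I, g is understood as a C^2 extension of the
   profile function across that endpoint. *)
Definition C2_on (I : R -> Prop) (g : R -> R) : Prop :=
  forall u, I u ->
    locally u (fun x => ex_derive g x /\ ex_derive (Derive g) x) /\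
    continuous (Derive (Derive g)) u.

Definition flat_profile (h alpha u : R) : R :=
  sqrt (alpha * u ^ 2 - h ^ 2)
  + h * atan (h / sqrt (alpha * u ^ 2 - h ^ 2)).

Definition radicand (h K0 gamma u : R) : R :=
  K0 * u ^ 4 - h ^ 2 + gamma * u ^ 2.
Definition a_fun (h K0 gamma u : R) : R := sqrt (radicand h K0 gamma u).

(* Principal square root of a real number, and principal logarithm. *)
Definition csqrt (x : R) : C := (sqrt x, sqrt (- x)).
Definition carg (z : C) : R :=
  if Rle_dec 0 (Im z) then acos (Re z / Cmod z) else - acos (Re z / Cmod z).
Definition clog (z : C) : C := (ln (Cmod z), carg z).

(* For K0 < 0 the root of K0 is imaginary, and the modulus of
   gamma + 2 (K0 u^2 + sqrt(K0) a) is the constant sqrt(gamma^2 + 4 K0 h^2), so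
   the bars in ln|.| cannot denote the complex modulus.  The formula is then
   read with the complex logarithm; the imaginary part of
   gamma / sqrt(K0) * log(gamma + 2 (K0 u^2 + sqrt(K0) a)) does not depend on u
   and is dropped, as part of the constant of integration. *)
Definition log_term (h K0 gamma u : R) : R :=
  if Rlt_dec 0 K0 then
    gamma / sqrt K0 *
      ln (Rabs (gamma + 2 * (K0 * u ^ 2 + sqrt K0 * a_fun h K0 gamma u)))
  else
    Re (RtoC gamma / csqrt K0 *
        clog (RtoC gamma
              + RtoC 2 * (RtoC (K0 * u ^ 2)
                          + csqrt K0 * RtoC (a_fun h K0 gamma u))))%C.

(* For h = 0 the arctangent has argument _ / 0, but its coefficient is 0. *)
Definition curved_profile (h K0 gamma u : R) : R :=
  / 4 * (2 * a_fun h K0 gamma u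
         - 2 * h * atan ((- 2 * h ^ 2 + gamma * u ^ 2)
                         / (2 * h * a_fun h K0 gamma u))
         + log_term h K0 gamma u).

(* The curvature determines the profile only up to sign and an additive
   constant; these correspond to the half-turn (x1, -x2, -x3), which keeps the
   pitch, and to translations along the axis. *)
Definition same_profile (I : R -> Prop) (g p : R -> R) : Prop :=
  exists eps c : R, (eps = 1 \/ eps = -1) /\
    forall u, I u -> g u = eps * p u + c.

(* Main.v *)
(* The curvature equation [u^3 g' g'' - h^2 = K0 u^4] integrates to
   [(u g')^2 = K0 u^4 - h^2 + gamma u^2].  The right-hand side has no zero on an
   interval with two points (unless [K0 = h = 0]), so [u g'] has
   constant sign there and [g' = eps * sqrt(K0 u^4 - h^2 + gamma u^2) / u]; the
   explicit profiles are primitives of this slope.  For [K0 < 0] the logarithmic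
   term is [gamma / sqrt(- K0)] times the argument of a complex number of
   constant modulus, whose real part is [gamma + 2 K0 u^2]. *)
Require Import Defs.
From Stdlib Require Import Reals Lra Psatz Classical.
From Coquelicot Require Import Coquelicot.

Open Scope R_scope.

(** * Functions on an interval: constancy and constant sign *)

Lemma is_derive_zero_const (I : R -> Prop) (f : R -> R) :
  is_interval I -> (forall u, I u -> is_derive f u 0) ->
  forall x y, I x -> I y -> f x = f y.
Proof.
  intros HI Hf.
  assert (W : forall x y, I x -> I y -> x < y -> f x = f y).
  { intros x y Hx Hy Hxy.
    apply (eq_is_derive f x y); [|exact Hxy].
    intros t Ht; apply Hf, (HI x t y); assumption. }
  intros x y Hx Hy.
  destruct (Rtotal_order x y) as [H|[H|H]].
  - now apply W.
  - now rewrite H.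
  - now symmetry; apply W.
Qed.

(** A change of sign between two points of [I] would produce a zero between them by the intermediate
    value theorem, and that zero lies in [I]. *)
Lemma nonvanishing_same_sign (I : R -> Prop) (w : R -> R) :
  is_interval I -> (forall u, I u -> continuity_pt w u) ->
  (forall u, I u -> w u <> 0) ->
  forall x y, I x -> I y -> 0 < w x -> 0 < w y.
Proof.
  intros HI Hc Hn x y Hx Hy Hwx.
  destruct (Rlt_or_le 0 (w y)) as [H|H]; [exact H|exfalso].
  assert (Hwy : w y < 0) by (specialize (Hn y Hy); lra).
  destruct (Rtotal_order x y) as [L|[L|L]].
  (* [IVT_interv] wants the negative value at the left end, hence [- w] here. *)
  - destruct (Ranalysis5.IVT_interv (fun t => - w t) x y) as [z [Hz Hz0]];
      try lra.
    + intros t Ht; apply (continuity_pt_opp w), Hc, (HI x t y); assumption.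
    + apply (Hn z); [apply (HI x z y); assumption|lra].
  - subst; lra.
  - destruct (Ranalysis5.IVT_interv w y x) as [z [Hz Hz0]]; try lra.
    + intros t Ht; apply Hc, (HI y t x); assumption.
    + apply (Hn z); [apply (HI y z x); assumption|lra].
Qed.

Lemma interval_avoiding_0_mul_pos (I : R -> Prop) :
  is_interval I -> ~ I 0 -> forall x y, I x -> I y -> 0 < x * y.
Proof.
  intros HI H0 x y Hx Hy.
  assert (Hx0 : x <> 0) by (intros ->; auto).
  assert (Hy0 : y <> 0) by (intros ->; auto).
  destruct (Rdichotomy _ _ Hx0), (Rdichotomy _ _ Hy0); try nra; exfalso; apply H0.
  - apply (HI x 0 y); auto; lra.
  - apply (HI y 0 x); auto; lra.
Qed.

Lemma triple_eq (A : Type) (a b c a' b' c' : A) :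
  a = a' -> b = b' -> c = c' -> (a, b, c) = (a', b', c').
Proof. now intros -> -> ->. Qed.

(** * Relative curvature of a helicoidal surface *)

Section Curvature.

Variables (h : R) (g : R -> R).

Lemma du_helicoidal (u v : R) :
  ex_derive g u -> du (helicoidal h g) u v = (cos v, sin v, Derive g u).
Proof.
  intros Hg; unfold du, helicoidal, px1, px2, px3; cbn [fst snd].
  apply triple_eq; apply is_derive_unique; auto_derive; auto; try ring.
  apply Rmult_1_l.
Qed.

Lemma dv_helicoidal (u v : R) :
  dv (helicoidal h g) u v = (- u * sin v, u * cos v, h).
Proof.
  unfold dv, helicoidal, px1, px2, px3; cbn [fst snd].
  apply triple_eq; apply is_derive_unique; auto_derive; auto; ring.
Qed.

(** Differentiating in [u] once more uses the formula for [du] at nearby parameters, so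
    differentiability of [g] is asked on a neighbourhood. *)
Lemma du_du_helicoidal (u v : R) :
  locally u (ex_derive g) ->
  du (du (helicoidal h g)) u v = (0, 0, Derive (Derive g) u).
Proof.
  intros Hg; unfold du at 1; apply triple_eq.
  - rewrite (Derive_ext_loc _ (fun _ => cos v)); [apply Derive_const|].
    revert Hg; apply filter_imp; intros t Ht; now rewrite du_helicoidal.
  - rewrite (Derive_ext_loc _ (fun _ => sin v)); [apply Derive_const|].
    revert Hg; apply filter_imp; intros t Ht; now rewrite du_helicoidal.
  - apply Derive_ext_loc.
    revert Hg; apply filter_imp; intros t Ht; now rewrite du_helicoidal.
Qed.

Lemma dv_du_helicoidal (u v : R) :
  ex_derive g u -> dv (du (helicoidal h g)) u v = (- sin v, cos v, 0).
Proof.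
  intros Hg; unfold dv; apply triple_eq.
  - rewrite (Derive_ext _ cos); [|now intros t; rewrite du_helicoidal].
    apply is_derive_unique; auto_derive; auto; ring.
  - rewrite (Derive_ext _ sin); [|now intros t; rewrite du_helicoidal].
    apply is_derive_unique; auto_derive; auto; ring.
  - rewrite (Derive_ext _ (fun _ => Derive g u));
      [|now intros t; rewrite du_helicoidal].
    apply Derive_const.
Qed.

Lemma dv_dv_helicoidal (u v : R) :
  dv (dv (helicoidal h g)) u v = (- u * cos v, - u * sin v, 0).
Proof.
  unfold dv at 1; apply triple_eq.
  - rewrite (Derive_ext _ (fun t => - u * sin t));
      [|now intros t; rewrite dv_helicoidal].
    apply is_derive_unique; auto_derive; auto; ring.
  - rewrite (Derive_ext _ (fun t => u * cos t));
      [|now intros t; rewrite dv_helicoidal].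
    apply is_derive_unique; auto_derive; auto; ring.
  - rewrite (Derive_ext _ (fun _ => h)); [|now intros t; rewrite dv_helicoidal].
    apply Derive_const.
Qed.

Lemma relative_curvature_helicoidal (u v : R) :
  u <> 0 -> locally u (ex_derive g) ->
  relative_curvature (helicoidal h g) u v =
    (u ^ 3 * Derive g u * Derive (Derive g) u - h ^ 2) / u ^ 4.
Proof.
  intros Hu Hg.
  assert (Hgu : ex_derive g u) by exact (locally_singleton _ _ Hg).
  assert (Hcs : cos v * cos v = 1 - sin v * sin v)
    by (generalize (sin2_cos2 v); unfold Rsqr; lra).
  assert (Hdet : det_g (helicoidal h g) u v = u ^ 2).
  { unfold det_g, g11, g12, g22, iso_inner.
    rewrite du_helicoidal, dv_helicoidal by assumption.
    unfold px1, px2; cbn [fst snd].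
    ring_simplify.
    replace (cos v ^ 4) with ((cos v * cos v) ^ 2) by ring.
    replace (cos v ^ 2) with (cos v * cos v) by ring.
    rewrite Hcs; ring. }
  unfold relative_curvature, det_h, h11, h12, h22, second_coeff.
  rewrite Hdet, du_du_helicoidal, dv_du_helicoidal, dv_dv_helicoidal,
    du_helicoidal, dv_helicoidal by assumption.
  unfold det3, px1, px2, px3; cbn [fst snd].
  (* This root is the absolute value of [u], and [u] may be negative. It divides every second
     coefficient once, so only its square [u ^ 2] enters the determinant. *)
  assert (Hs : sqrt (u ^ 2) <> 0).
  { intros E; apply sqrt_eq_0 in E; [|nra]. apply Hu; nra. }
  assert (Hs2 : sqrt (u ^ 2) ^ 2 = u ^ 2) by (rewrite pow2_sqrt; nra).
  set (s := sqrt (u ^ 2)) in *.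
  match goal with |- (?A / s * (?B / s) - (?C / s) ^ 2) / _ = _ =>
    replace A with (u * Derive (Derive g) u * (cos v * cos v + sin v * sin v))
      by ring;
    replace B with (u ^ 2 * Derive g u * (cos v * cos v + sin v * sin v))
      by ring;
    replace C with (- h * (cos v * cos v + sin v * sin v)) by ring
  end.
  rewrite Hcs.
  transitivity ((u ^ 3 * Derive g u * Derive (Derive g) u - h ^ 2)
                / s ^ 2 / u ^ 2); [field; auto|].
  rewrite Hs2; field; auto.
Qed.

End Curvature.

(** * The integrated curvature equation and the sign of its right-hand side *)

Lemma first_integral (I : R -> Prop) (h K0 : R) (g' g'' : R -> R) :
  is_interval I -> ~ I 0 ->
  (forall u, I u -> is_derive g' u (g'' u)) ->
  (forall u, I u -> u ^ 3 * g' u * g'' u - h ^ 2 = K0 * u ^ 4) ->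
  exists gamma, forall u, I u -> (u * g' u) ^ 2 = radicand h K0 gamma u.
Proof.
  intros HI H0 Hg Hode.
  destruct (classic (exists u0, I u0)) as [[u0 Hu0]|Hemp];
    [|exists 0; intros u Hu; destruct Hemp; eauto].
  (* [F] is the integrated equation solved for [gamma]; [u ^ 3] times its derivative is twice the
     difference of the two sides of the curvature equation. *)
  set (F := fun u => g' u ^ 2 - K0 * u ^ 2 + h ^ 2 / u ^ 2).
  assert (HF : forall u, I u -> F u = F u0).
  { intros u Hu; apply (is_derive_zero_const I F HI); [|exact Hu|exact Hu0].
    clear u Hu; intros u Hu.
    assert (Hu' : u <> 0) by (intros ->; auto).
    specialize (Hg u Hu); specialize (Hode u Hu).
    unfold F; auto_derive.
    - repeat split; [eexists; exact Hg|]; intros E; apply Hu'; nra.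
    - rewrite (is_derive_unique (fun x : R => g' x) _ _ Hg).
      apply (Rmult_eq_reg_l (u ^ 3)); [|now apply pow_nonzero].
      transitivity (2 * (u ^ 3 * g' u * g'' u - h ^ 2 - K0 * u ^ 4));
        [field; auto|rewrite Hode; ring]. }
  exists (F u0); intros u Hu.
  assert (Hu' : u <> 0) by (intros ->; auto).
  unfold radicand; rewrite <- (HF u Hu); unfold F; field; auto.
Qed.

                                                                     
                                                           
                                    
(** At a zero [u] of the radicand [g'] vanishes, so the curvature equation gives
    [K0 * u ^ 4 = - h ^ 2], and then [gamma * u ^ 2 = 2 * h ^ 2]. Thus [u ^ 2] is a double root of
    the radicand as a quadratic in the squared variable, with negative leading coefficient. At any
    other point of [I] the radicand is then negative, although it is a square there. *)
Lemma radicand_pos (I : R -> Prop) (h K0 gamma : R) (g' g'' : R -> R) :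
  is_interval I -> ~ I 0 -> (exists x y, I x /\ I y /\ x <> y) ->
  K0 <> 0 \/ h <> 0 ->
  (forall u, I u -> u ^ 3 * g' u * g'' u - h ^ 2 = K0 * u ^ 4) ->
  (forall u, I u -> (u * g' u) ^ 2 = radicand h K0 gamma u) ->
  forall u, I u -> 0 < radicand h K0 gamma u.
Proof.
  intros HI H0 (x & y & Hx & Hy & Hxy) Hnd Hode Hsq u Hu.
  assert (Hu' : u <> 0) by (intros ->; auto).
  assert (Hge : forall t, I t -> 0 <= radicand h K0 gamma t)
    by (intros t Ht; rewrite <- Hsq by assumption; nra).
  destruct (Hge u Hu) as [H|Hr]; [exact H|exfalso].
  assert (Hg : g' u = 0).
  { assert (E := Hsq u Hu); rewrite <- Hr in E.
    assert (E' : u * g' u = 0) by nra.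
    now destruct (Rmult_integral _ _ E'). }
  assert (HK : K0 * u ^ 4 = - h ^ 2)
    by (rewrite <- (Hode u Hu), Hg; ring).
  assert (Hh : h <> 0).
  { intros ->. destruct Hnd as [Hnd|Hnd]; auto. apply Hnd.
    apply (Rmult_eq_reg_r (u ^ 4)); [lra|now apply pow_nonzero]. }
  assert (Hgam : gamma * u ^ 2 = 2 * h ^ 2) by (unfold radicand in Hr; lra).
  assert (Hz : exists z, I z /\ z <> u).
  { destruct (Req_dec x u) as [E|E]; [exists y|exists x]; split; auto; lra. }
  destruct Hz as [z [Hz Hzu]].
  assert (Hp := interval_avoiding_0_mul_pos I HI H0 z u Hz Hu).
  (* [z = - u] is excluded because [I] lies on one side of 0. *)
  assert (Hd : z ^ 2 - u ^ 2 <> 0).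
  { intros E.
    assert (E' : (z - u) * (z + u) = 0) by (ring_simplify; lra).
    destruct (Rmult_integral _ _ E'); nra. }
  assert (Hneg : radicand h K0 gamma z * u ^ 4
                 = - (h * (z ^ 2 - u ^ 2)) ^ 2).
  { unfold radicand.
    transitivity (K0 * u ^ 4 * z ^ 4 - h ^ 2 * u ^ 4
                  + gamma * u ^ 2 * u ^ 2 * z ^ 2); [ring|].
    rewrite HK, Hgam; ring. }
  assert (Hsqp : 0 < (h * (z ^ 2 - u ^ 2)) ^ 2).
  { apply pow2_gt_0. now apply Rmult_integral_contrapositive_currified. }
  assert (Hu4 : 0 < u ^ 4) by (replace (u ^ 4) with ((u ^ 2) ^ 2) by ring;
    apply pow2_gt_0; now apply pow_nonzero).
  specialize (Hge z Hz); nra.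
Qed.

(** The continuous function [u * g'] has the nonzero square [q], hence a constant sign [eps]. So
    [g' = eps * sqrt q / u], and [g - eps * p] has derivative zero. *)
Lemma same_profile_of_slope (I : R -> Prop) (g p q : R -> R) :
  is_interval I -> ~ I 0 ->
  (forall u, I u -> ex_derive g u) ->
  (forall u, I u -> continuous (Derive g) u) ->
  (forall u, I u -> 0 < q u) ->
  (forall u, I u -> (u * Derive g u) ^ 2 = q u) ->
  (forall u, I u -> is_derive p u (sqrt (q u) / u)) ->
  same_profile I g p.
Proof.
  intros HI H0 Hg Hc Hq Hsq Hp.
  destruct (classic (exists u0, I u0)) as [[u0 Hu0]|Hemp];
    [|exists 1, 0; split; [now left|]; intros u Hu; destruct Hemp; eauto].
  set (w := fun u => u * Derive g u).
  assert (Hwc : forall u, I u -> continuity_pt w u).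
  { intros u Hu; apply (continuity_pt_mult (fun x => x)).
    - apply continuity_pt_id.
    - apply continuity_pt_filterlim, Hc, Hu. }
  assert (Hwn : forall u, I u -> w u <> 0).
  { intros u Hu E; specialize (Hsq u Hu); specialize (Hq u Hu).
    fold (w u) in Hsq; rewrite E in Hsq; lra. }
  assert (Heps : exists eps, (eps = 1 \/ eps = -1) /\
                   forall u, I u -> 0 < eps * w u).
  { destruct (Rdichotomy _ _ (Hwn u0 Hu0)) as [H|H].
    - exists (-1); split; [now right|]; intros u Hu.
      apply (nonvanishing_same_sign I (fun t => -1 * w t) HI) with (x := u0);
        auto; [| |lra].
      + intros t Ht; apply (continuity_pt_scal w); auto.
      + intros t Ht; specialize (Hwn t Ht); lra.
    - exists 1; split; [now left|]; intros u Hu; rewrite Rmult_1_l.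
      now apply (nonvanishing_same_sign I w HI Hwc Hwn) with (x := u0). }
  destruct Heps as [eps [He Hpos]].
  exists eps, (g u0 - eps * p u0); split; [exact He|]; intros u Hu.
  assert (E : g u - eps * p u = g u0 - eps * p u0); [|lra].
  apply (is_derive_zero_const I (fun t => g t - eps * p t) HI); auto.
  clear u Hu; intros u Hu.
  assert (Hu' : u <> 0) by (intros ->; auto).
  assert (Hd : Derive g u = eps * (sqrt (q u) / u)).
  (* Since [eps ^ 2 = 1], [eps * w u] is the positive square root of [q u]. *)
  { assert (Hs : sqrt (q u) = eps * w u).
    { rewrite <- Hsq by assumption.
      replace ((u * Derive g u) ^ 2) with ((eps * w u) ^ 2)
        by (unfold w; destruct He as [->| ->]; ring).
      apply sqrt_pow2, Rlt_le, Hpos, Hu. }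
    rewrite Hs; unfold w; destruct He as [->| ->]; field; auto. }
  replace 0 with (Derive g u - eps * (sqrt (q u) / u)) by (rewrite Hd; ring).
  apply (is_derive_minus g (fun t => eps * p t)).
  - now apply Derive_correct, Hg.
  - now apply is_derive_scal, Hp.
Qed.

(** * Primitive of the slope in the flat case *)

Lemma is_derive_flat_profile (h alpha u : R) :
  u <> 0 -> 0 < alpha * u ^ 2 - h ^ 2 ->
  is_derive (flat_profile h alpha) u (sqrt (alpha * u ^ 2 - h ^ 2) / u).
Proof.
  intros Hu Hr.
  assert (Hs : 0 < sqrt (alpha * u ^ 2 - h ^ 2)) by now apply sqrt_lt_R0.
  assert (Hs2 : sqrt (alpha * u ^ 2 - h ^ 2) ^ 2 = alpha * u ^ 2 - h ^ 2)
    by (rewrite pow2_sqrt; lra).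
  assert (Ha : 0 < alpha) by nra.
  unfold flat_profile; auto_derive.
  - replace (alpha * (u * (u * 1)) + - (h * (h * 1)))
      with (alpha * u ^ 2 - h ^ 2) by ring.
    repeat split; auto; lra.
  - replace (alpha * (u * (u * 1)) + - (h * (h * 1)))
      with (alpha * u ^ 2 - h ^ 2) by ring.
    set (s := sqrt (alpha * u ^ 2 - h ^ 2)) in *.
    (* This is the denominator produced by the arctangent; it collapses to [alpha * u ^ 2]. *)
    assert (Hden : s ^ 2 + h ^ 2 = alpha * u ^ 2) by lra.
    transitivity (alpha * u / s - h ^ 2 * (alpha * u) / (s * (s ^ 2 + h ^ 2))).
    { field; repeat split; nra. }
    rewrite Hden.
    transitivity ((alpha * u ^ 2 - h ^ 2) / (s * u)).
    { field; repeat split; lra. }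
    rewrite <- Hs2; field; repeat split; lra.
Qed.

(** * Derivatives of the root, arctangent and logarithmic terms *)

Section Radicand.

Variables (h K0 gamma u : R).
Hypotheses (Hu : u <> 0) (Hrad : 0 < radicand h K0 gamma u).

Let a := a_fun h K0 gamma u.

Lemma a_fun_pos : 0 < a.
Proof. now apply sqrt_lt_R0. Qed.

Lemma a_fun_sq : a ^ 2 = radicand h K0 gamma u.
Proof. apply pow2_sqrt; lra. Qed.

(** Allows [log_term_neg], an identity valid where the radicand is positive, to be
    differentiated. *)
Lemma locally_radicand_pos : locally u (fun t => 0 < radicand h K0 gamma t).
Proof.
  apply (open_comp (radicand h K0 gamma) (fun y => 0 < y)); [|apply open_gt|exact Hrad].
  intros x _; apply @ex_derive_continuous; unfold radicand; auto_derive; auto.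
Qed.

Lemma is_derive_a_fun :
  is_derive (a_fun h K0 gamma) u ((2 * K0 * u ^ 3 + gamma * u) / a).
Proof.
  assert (Ha := a_fun_pos).
  unfold a_fun, radicand; auto_derive.
  - unfold radicand in Hrad; nra.
  - match goal with |- context [sqrt ?x] =>
      replace (sqrt x) with a by (unfold a, a_fun, radicand; f_equal; ring) end.
    field; lra.
Qed.

                                                                
(** The quantity is the discriminant of the radicand as a quadratic in [u ^ 2]. Completing the
    square settles [K0 < 0]; for [K0 > 0] the term in [h] is positive; for [K0 = 0] the radicand is
    positive only if [gamma] is. *)
Lemma discriminant_pos : h <> 0 \/ K0 < 0 -> 0 < gamma ^ 2 + 4 * K0 * h ^ 2.
Proof.
  intros Hnd.
  assert (Hu2 : 0 < u ^ 2) by now apply pow2_gt_0.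
  assert (E : (gamma + 2 * K0 * u ^ 2) ^ 2 - 4 * K0 * radicand h K0 gamma u
              = gamma ^ 2 + 4 * K0 * h ^ 2) by (unfold radicand; ring).
  destruct (Rlt_or_le K0 0) as [HK|HK].
  - rewrite <- E. assert (0 < - K0 * radicand h K0 gamma u) by nra.
    assert (H2 := pow2_ge_0 (gamma + 2 * K0 * u ^ 2)). lra.
  - assert (Hh : h <> 0) by (destruct Hnd; auto; lra).
    assert (Hh2 : 0 < h ^ 2) by now apply pow2_gt_0.
    destruct HK as [HK|HK].
    + assert (0 < K0 * h ^ 2) by nra. assert (H2 := pow2_ge_0 gamma). lra.
    + unfold radicand in Hrad; rewrite <- HK in *.
      assert (0 < gamma) by nra. nra.
Qed.

Lemma is_derive_curved_atan :
  is_derive (fun t => 2 * h * atan ((- 2 * h ^ 2 + gamma * t ^ 2)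
                                    / (2 * h * a_fun h K0 gamma t)))
    u (4 * h ^ 2 / (u * a)).
Proof.
  assert (Ha := a_fun_pos); assert (Ha2 := a_fun_sq).
  (* For [h = 0] the factor [2 * h] makes the term zero, whatever value the division by 0 has. *)
  destruct (Req_dec h 0) as [E|Hh].
  { apply (is_derive_ext (fun _ => 0)); [intros t; rewrite E, Rmult_0_r, Rmult_0_l; reflexivity|].
    replace (4 * h ^ 2 / (u * a)) with 0 by (rewrite E; field; lra).
    exact (is_derive_const 0 u). }
  assert (HD := discriminant_pos (or_introl Hh)).
  assert (Hda := is_derive_a_fun).
  auto_derive.
  - repeat split; [eexists; exact Hda|].
    change (a_fun h K0 gamma u) with a.
    apply Rmult_integral_contrapositive_currified; lra.
  - rewrite (is_derive_unique (fun x : R => a_fun h K0 gamma x) _ _ Hda).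
    change (a_fun h K0 gamma u) with a.
    set (D := gamma ^ 2 + 4 * K0 * h ^ 2) in *.
    set (N := - 2 * h ^ 2 + gamma * u ^ 2).
    (* Both the denominator and the numerator of the derivative are powers of [u] times the
       discriminant [D], which therefore cancels. *)
    assert (HN : N ^ 2 + (2 * h * a) ^ 2 = u ^ 4 * D).
    { transitivity (N ^ 2 + 4 * h ^ 2 * a ^ 2); [ring|].
      rewrite Ha2; unfold N, D, radicand; ring. }
    assert (Hnum : 2 * gamma * u * a ^ 2 - N * (2 * K0 * u ^ 3 + gamma * u)
                   = u ^ 3 * D).
    { rewrite Ha2; unfold N, D, radicand; ring. }
    assert (HuD : u ^ 4 * D <> 0).
    { apply Rmult_integral_contrapositive_currified; [now apply pow_nonzero|lra]. }
    transitivity (2 * h * (2 * h * ((2 * gamma * u * a ^ 2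
                            - N * (2 * K0 * u ^ 3 + gamma * u)) / a))
                  / (N ^ 2 + (2 * h * a) ^ 2)).
    { unfold N in *; field; repeat split; try lra; rewrite <- HN in HuD;
        intros Z; apply HuD; rewrite <- Z; ring. }
    rewrite HN, Hnum; field; repeat split; lra.
Qed.

Lemma is_derive_log_term_pos :
  0 < K0 -> is_derive (log_term h K0 gamma) u (2 * gamma * u / a).
Proof.
  intros HK.
  assert (Ha := a_fun_pos); assert (Ha2 := a_fun_sq).
  assert (Hda := is_derive_a_fun).
  assert (Hk : 0 < sqrt K0) by now apply sqrt_lt_R0.
  assert (Hk2 : sqrt K0 ^ 2 = K0) by (apply pow2_sqrt; lra).
  apply (is_derive_ext (fun t => gamma / sqrt K0 *
    ln (Rabs (gamma + 2 * (K0 * t ^ 2 + sqrt K0 * a_fun h K0 gamma t))))).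
  { intros t; unfold log_term; destruct (Rlt_dec 0 K0); [reflexivity|contradiction]. }
  set (k := sqrt K0) in *.
  (* For [gamma = 0] the whole term is 0; the other case uses [gamma <> 0] to keep the logarithm
     away from its singularity. *)
  destruct (Req_dec gamma 0) as [E|Hgam].
  { apply (is_derive_ext (fun _ => 0)); [intros t; unfold Rdiv; rewrite E, !Rmult_0_l; reflexivity|].
    replace (2 * gamma * u / a) with 0 by (rewrite E; field; lra).
    exact (is_derive_const 0 u). }
                                                        
  (* Multiplying by the conjugate, with [- k] for [k], gives [gamma ^ 2 + 4 * K0 * h ^ 2], which is
     positive. *)
  assert (HL : gamma + 2 * (K0 * u ^ 2 + k * a) <> 0).
  { intros E.
    assert (E' : (gamma + 2 * (K0 * u ^ 2 + k * a))
                 * (gamma + 2 * (K0 * u ^ 2 - k * a))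
                 = gamma ^ 2 + 4 * K0 * h ^ 2).
    { transitivity ((gamma + 2 * K0 * u ^ 2) ^ 2 - 4 * k ^ 2 * a ^ 2); [ring|].
      rewrite Hk2, Ha2; unfold radicand; ring. }
    rewrite E in E'.
    assert (0 < gamma ^ 2) by now apply pow2_gt_0.
    assert (0 <= K0 * h ^ 2) by (apply Rmult_le_pos; [lra|apply pow2_ge_0]).
    lra. }
  set (L := fun t => gamma + 2 * (K0 * t ^ 2 + k * a_fun h K0 gamma t)).
  (* [L] is a factor of its own derivative, so the logarithmic derivative is just
     [2 * k * u / a]. *)
  assert (HdL : is_derive L u (2 * k * u / a * L u)).
  { unfold L; auto_derive; [eexists; exact Hda|].
    rewrite (is_derive_unique (fun x : R => a_fun h K0 gamma x) _ _ Hda).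
    change (a_fun h K0 gamma u) with a.
    rewrite <- Hk2; field; lra. }
  change (is_derive (fun t => gamma / k * ln (Rabs (L t))) u (2 * gamma * u / a)).
  change (L u <> 0) in HL.
  assert (Hln : is_derive (fun t => ln (Rabs (L t))) u
                  (2 * k * u / a * L u * (sign (L u) * / Rabs (L u)))).
  { auto_derive.
    - repeat split; auto; [eexists; exact HdL|now apply Rabs_pos_lt].
    - rewrite (is_derive_unique (fun x : R => L x) _ _ HdL); ring. }
  replace (2 * gamma * u / a) with (gamma / k *
    (2 * k * u / a * L u * (sign (L u) * / Rabs (L u)))).
  { now apply is_derive_scal. }
  assert (Hsg : L u * (sign (L u) * / Rabs (L u)) = 1).
  { destruct (Rdichotomy _ _ HL) as [H|H].
    - rewrite sign_eq_m1, Rabs_left by exact H; field; lra.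
    - rewrite sign_eq_1, Rabs_pos_eq by lra; field; lra. }
  transitivity (gamma / k * (2 * k * u / a) *
    (L u * (sign (L u) * / Rabs (L u)))); [ring|].
  rewrite Hsg; field; lra.
Qed.

(** With [k = sqrt (- K0)] the root of [K0] is [i k], and the argument of the logarithm is
    [gamma + 2 * K0 * u ^ 2 + 2 k a i]. Its imaginary part is nonnegative, so [carg] is the
    arccosine itself, and dividing by [i k] turns that angle into the real part. *)
Lemma log_term_neg :
  K0 < 0 ->
  log_term h K0 gamma u =
    gamma / sqrt (- K0) *
    acos ((gamma + 2 * K0 * u ^ 2) / sqrt (gamma ^ 2 + 4 * K0 * h ^ 2)).
Proof.
  intros HK.
  assert (Ha := a_fun_pos); assert (Ha2 := a_fun_sq).
  assert (Hk : 0 < sqrt (- K0)) by (apply sqrt_lt_R0; lra).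
  assert (Hk2 : sqrt (- K0) ^ 2 = - K0) by (apply pow2_sqrt; lra).
  unfold log_term; destruct (Rlt_dec 0 K0) as [H|_]; [lra|].
  change (a_fun h K0 gamma u) with a.
  unfold csqrt; rewrite (sqrt_neg_0 K0) by lra.
  set (k := sqrt (- K0)) in *.
  set (z := (RtoC gamma + _)%C).
  assert (Hz : z = (gamma + 2 * K0 * u ^ 2, 2 * k * a)).
  { unfold z, Cplus, Cmult, RtoC; cbn [fst snd]; f_equal; ring. }
  assert (Hm : Cmod z = sqrt (gamma ^ 2 + 4 * K0 * h ^ 2)).
  { rewrite Hz; unfold Cmod; cbn [fst snd]; f_equal.
    transitivity ((gamma + 2 * K0 * u ^ 2) ^ 2 + 4 * k ^ 2 * a ^ 2); [ring|].
    rewrite Hk2, Ha2; unfold radicand; ring. }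
  unfold clog, carg; rewrite Hm, Hz; unfold Re, Im; cbn [fst snd].
  destruct (Rle_dec 0 (2 * k * a)) as [_|H]; [|exfalso; apply H; nra].
  unfold Cdiv, Cinv, Cmult, RtoC; cbn [fst snd].
  field; lra.
Qed.

End Radicand.

Lemma is_derive_log_term_neg (h K0 gamma u : R) :
  u <> 0 -> 0 < radicand h K0 gamma u -> K0 < 0 ->
  is_derive (log_term h K0 gamma) u (2 * gamma * u / a_fun h K0 gamma u).
Proof.
  intros Hu Hrad HK.
  assert (Ha := a_fun_pos _ _ _ _ Hrad); assert (Ha2 := a_fun_sq _ _ _ _ Hrad).
  assert (HD := discriminant_pos _ _ _ _ Hu Hrad (or_intror HK)).
  apply (is_derive_ext_loc (fun t => gamma / sqrt (- K0) *
    acos ((gamma + 2 * K0 * t ^ 2) / sqrt (gamma ^ 2 + 4 * K0 * h ^ 2)))).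
  { generalize (locally_radicand_pos _ _ _ _ Hrad); apply filter_imp.
    intros t Ht; symmetry; now apply log_term_neg. }
  assert (Hk : 0 < sqrt (- K0)) by (apply sqrt_lt_R0; lra).
  assert (Hk2 : sqrt (- K0) ^ 2 = - K0) by (apply pow2_sqrt; lra).
  assert (Hm : 0 < sqrt (gamma ^ 2 + 4 * K0 * h ^ 2)) by now apply sqrt_lt_R0.
  assert (Hm2 : sqrt (gamma ^ 2 + 4 * K0 * h ^ 2) ^ 2
                = gamma ^ 2 + 4 * K0 * h ^ 2) by (apply pow2_sqrt; lra).
  set (m := sqrt (gamma ^ 2 + 4 * K0 * h ^ 2)) in *.
  set (k := sqrt (- K0)) in *.
  set (a := a_fun h K0 gamma u) in *.
  set (x := fun t => (gamma + 2 * K0 * t ^ 2) / m).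
  (* An explicit square for [1 - x ^ 2] puts [x u] strictly between -1 and 1, where [acos] is
     differentiable, and removes the root from its derivative. *)
  assert (Hx : 1 - (x u)² = (2 * k * a / m) ^ 2).
  { unfold x, Rsqr.
    apply (Rmult_eq_reg_r (m ^ 2)); [|apply pow_nonzero; lra].
    transitivity (m ^ 2 - (gamma + 2 * K0 * u ^ 2) ^ 2); [field; lra|].
    transitivity (4 * k ^ 2 * a ^ 2); [|field; lra].
    rewrite Hm2, Hk2, Ha2; unfold radicand; ring. }
  assert (Hpos : 0 < 2 * k * a / m).
  { apply Rdiv_lt_0_compat; [|exact Hm]. repeat apply Rmult_lt_0_compat; lra. }
  assert (Hr : -1 < x u < 1) by (unfold Rsqr in Hx; nra).
  assert (Hacos : is_derive acos (x u) (- 1 / (2 * k * a / m))).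
  { rewrite <- (sqrt_pow2 (2 * k * a / m)), <- Hx by lra.
    rewrite <- (derive_pt_acos (x u) Hr).
    apply is_derive_Reals.
    eapply derive_pt_eq_1; reflexivity. }
  assert (Hdx : is_derive x u (4 * K0 * u / m))
    by (unfold x; auto_derive; auto; field; lra).
  replace (2 * gamma * u / a) with
    (gamma / k * (4 * K0 * u / m * (- 1 / (2 * k * a / m)))).
  - apply is_derive_scal.
    exact (is_derive_comp acos x u _ _ Hacos Hdx).
  - replace K0 with (- k ^ 2) by lra; field; repeat split; lra.
Qed.

Lemma is_derive_curved_profile (h K0 gamma u : R) :
  u <> 0 -> K0 <> 0 -> 0 < radicand h K0 gamma u ->
  is_derive (curved_profile h K0 gamma) u (sqrt (radicand h K0 gamma u) / u).
Proof.
  intros Hu HK Hrad.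
  assert (Ha := a_fun_pos _ _ _ _ Hrad); assert (Ha2 := a_fun_sq _ _ _ _ Hrad).
  change (sqrt (radicand h K0 gamma u)) with (a_fun h K0 gamma u).
  assert (Hlog : is_derive (log_term h K0 gamma) u
                   (2 * gamma * u / a_fun h K0 gamma u)).
  { destruct (Rdichotomy _ _ HK).
    - now apply is_derive_log_term_neg.
    - now apply is_derive_log_term_pos. }
  assert (Hat := is_derive_curved_atan _ _ _ _ Hu Hrad).
  assert (Hda := is_derive_a_fun _ _ _ _ Hrad).
  set (a := a_fun h K0 gamma u) in *.
  replace (a / u) with (/ 4 * (2 * ((2 * K0 * u ^ 3 + gamma * u) / a)
    - 4 * h ^ 2 / (u * a) + 2 * gamma * u / a)).
  - unfold curved_profile; apply is_derive_scal.
    apply @is_derive_plus; [|exact Hlog].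
    apply @is_derive_minus; [|exact Hat].
    now apply is_derive_scal.
  (* The three derivatives add up to the radicand over [a * u], and the radicand is [a ^ 2]. *)
  - transitivity ((K0 * u ^ 4 - h ^ 2 + gamma * u ^ 2) / (a * u)).
    + field; lra.
    + change (radicand h K0 gamma u / (a * u) = a / u).
      rewrite <- Ha2; field; lra.
Qed.

(** * Classification of the profiles of constant relative curvature *)

Lemma same_profile_singleton (I : R -> Prop) (g p : R -> R) (u0 : R) :
  (forall u, I u -> u = u0) -> same_profile I g p.
Proof.
  intros H; exists 1, (g u0 - p u0); split; [now left|].
  intros u Hu; rewrite (H u Hu); ring.
Qed.

                                                                                
                                                         
(** The alternative [alpha = 0], [h = 0] is the horizontal plane: it is flat with pitch 0, and
    [flat_profile] reduces to 0. *)
Theorem theorem3p1 :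
  forall (h K0 : R) (I : R -> Prop) (g : R -> R),
    is_interval I -> ~ I 0 -> C2_on I g ->
    (forall u v, I u -> relative_curvature (helicoidal h g) u v = K0) ->
    (K0 = 0 ->
       exists alpha : R,
         ((0 < alpha /\ forall u, I u -> 0 < alpha * u ^ 2 - h ^ 2)
          \/ (alpha = 0 /\ h = 0)) /\
         same_profile I g (flat_profile h alpha)) /\
    (K0 <> 0 ->
       exists gamma : R,
         (forall u, I u -> 0 < radicand h K0 gamma u) /\
         same_profile I g (curved_profile h K0 gamma)).
Proof.
  intros h K0 I g HI H0 HC2 HK.
  assert (Hn0 : forall u, I u -> u <> 0) by (intros u Hu ->; auto).
  destruct (classic (exists x y, I x /\ I y /\ x <> y)) as [Htwo|Hone].
  (* On an empty or one-point [I] the integrated radicand could vanish, so the parameter is chosen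
     to give it the value 1 at [u0]; the additive constant then matches the profiles. *)
  2: {                                                                    
    assert (Hu0 : exists u0, u0 <> 0 /\ forall u, I u -> u = u0).
    { destruct (classic (exists u0, I u0)) as [[u0 Hu0]|Hemp].
      - exists u0; split; auto; intros u Hu.
        apply NNPP; intros E; apply Hone; eauto.
      - exists 1; split; [lra|]; intros u Hu; destruct Hemp; eauto. }
    destruct Hu0 as [u0 [Hu0 Hall]].
    assert (Hp : 0 < u0 ^ 2) by now apply pow2_gt_0.
    split; intros HK0.
    - exists ((h ^ 2 + 1) / u0 ^ 2); split;
        [left; split|now apply same_profile_singleton with u0].
      + apply Rdiv_lt_0_compat; [|exact Hp]. assert (H2 := pow2_ge_0 h); lra.
      + intros u Hu; rewrite (Hall u Hu).
        replace (_ - h ^ 2) with 1 by (field; auto); lra.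
    - exists ((h ^ 2 - K0 * u0 ^ 4 + 1) / u0 ^ 2); split;
        [|now apply same_profile_singleton with u0].
      intros u Hu; rewrite (Hall u Hu); unfold radicand.
      match goal with |- 0 < ?x => replace x with 1 by (field; auto) end; lra. }
  assert (Hg : forall u, I u -> ex_derive g u).
  { intros u Hu. destruct (HC2 u Hu) as [Hl _].
    exact (proj1 (locally_singleton _ _ Hl)). }
  assert (Hg' : forall u, I u -> is_derive (Derive g) u (Derive (Derive g) u)).
  { intros u Hu. destruct (HC2 u Hu) as [Hl _].
    exact (Derive_correct _ _ (proj2 (locally_singleton _ _ Hl))). }
  assert (Hgc : forall u, I u -> continuous (Derive g) u).
  { intros u Hu; apply @ex_derive_continuous; eexists; now apply Hg'. }
  assert (Hode : forall u, I u ->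
            u ^ 3 * Derive g u * Derive (Derive g) u - h ^ 2 = K0 * u ^ 4).
  { intros u Hu. specialize (Hn0 u Hu).
    rewrite <- (HK u 0 Hu), relative_curvature_helicoidal; auto; [field; auto|].
    destruct (HC2 u Hu) as [Hl _]; revert Hl; apply filter_imp; tauto. }
  destruct (first_integral I h K0 _ _ HI H0 Hg' Hode) as [gamma Hsq].
  assert (Hrad := radicand_pos I h K0 gamma (Derive g) (Derive (Derive g)) HI H0 Htwo).
  split; intros HK0.
  - assert (Hr0 : forall u, radicand h K0 gamma u = gamma * u ^ 2 - h ^ 2)
      by (intros u; unfold radicand; rewrite HK0; ring).
    (* For [K0 = 0], [radicand_pos] covers [h <> 0]. For [h = 0] the square
       [(x * Derive g x) ^ 2 = gamma * x ^ 2] shows that [gamma] is zero or positive. *)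
    assert (Hcase : (gamma = 0 /\ h = 0) \/
              (0 < gamma /\ forall u, I u -> 0 < gamma * u ^ 2 - h ^ 2)).
    { destruct Htwo as (x & _ & Hx & _).
      assert (Hx2 : 0 < x ^ 2) by now apply pow2_gt_0, Hn0.
      destruct (Req_dec h 0) as [Hh|Hh].
      - assert (Hge := pow2_ge_0 (x * Derive g x)).
        rewrite (Hsq x Hx), Hr0, Hh in Hge.
        destruct (Req_dec gamma 0) as [E|E]; [now left|right].
        assert (Hgam : 0 < gamma) by nra.
        split; [exact Hgam|]; intros u Hu; rewrite Hh.
        assert (0 < u ^ 2) by now apply pow2_gt_0, Hn0.
        nra.
      - right.
        assert (Hpos : forall u, I u -> 0 < gamma * u ^ 2 - h ^ 2)
          by (intros u Hu; rewrite <- Hr0; auto).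
        split; [|exact Hpos].
        specialize (Hpos x Hx). assert (H2 := pow2_ge_0 h); nra. }
    exists gamma; split; [tauto|].
    destruct Hcase as [[Hgam Hh]|[Hgam Hpos]].
    + destruct Htwo as (x & _ & Hx & _).
      (* Here [u * g'] has square 0, so [g] is constant and its value is the additive constant. *)
      exists 1, (g x); split; [now left|]; intros u Hu.
      replace (flat_profile h gamma u) with 0.
      * rewrite Rmult_0_r, Rplus_0_l.
        apply (is_derive_zero_const I g HI); auto.
        intros t Ht.
        replace 0 with (Derive g t); [now apply Derive_correct, Hg|].
        assert (E := Hsq t Ht); rewrite Hr0, Hgam, Hh in E.
        assert (E' : t * Derive g t = 0) by nra.
        destruct (Rmult_integral _ _ E'); auto; now destruct (Hn0 t Ht).
      * unfold flat_profile; rewrite Hgam, Hh.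
        replace (0 * u ^ 2 - 0 ^ 2) with 0 by ring; rewrite sqrt_0; ring.
    + apply same_profile_of_slope with (q := fun u => gamma * u ^ 2 - h ^ 2); auto.
      * intros u Hu; rewrite <- Hr0; auto.
      * intros u Hu; apply is_derive_flat_profile; auto.
  - assert (Hpos := Hrad (or_introl HK0) Hode Hsq).
    exists gamma; split; [exact Hpos|].
    apply same_profile_of_slope with (q := radicand h K0 gamma); auto.
    intros u Hu; apply is_derive_curved_profile; auto.
Qed.
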